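(* For each $n\in\mathbb{N}$ such that $n\geqslant 2$, there exists a finite non-commutative completely regular semigroup whose commuting graph has girth equal to $2n$.
   Context: A semigroup $S$ is completely regular if it is equipped with a unary operation $x\mapsto x^{-1}$ such that for all $x\in S$: $(x^{-1})^{-1}=x$, $xx^{-1}x=x$, and $x^{-1}x=xx^{-1}$. Equivalently, every element of $S$ lies in a subgroup of $S$. The center of $S$ is $Z(S)=\{x\in S: xy=yx \text{ for all } y\in S\}$. The commuting graph of a finite non-commutative semigroup $S$ is the simple graph with vertex set $S\setminus Z(S)$ in which two distinct vertices $x,y$ are adjacent if and only if $xy=yx$. The girth of a simple graph containing cycles is the length (number of edges) of a shortest cycle; if the graph contains no cycles, the girth is $\infty$. *)

(* Defs.v *)
From HB Require Import structures.
From mathcomp Require Import all_boot.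

Set Implicit Arguments.
Unset Strict Implicit.
Unset Printing Implicit Defensive.

Local Open Scope group_scope.

#[short(type="finSemigroupType")]
HB.structure Definition FinSemigroup := { S of Semigroup S & Finite S }.

Definition completely_regular (S : semigroupType) : Prop :=
  exists inv : S -> S,
    [/\ forall x, inv (inv x) = x,
        forall x, x * inv x * x = x
      & forall x, inv x * x = x * inv x].

Definition semigroup_center (S : finSemigroupType) : {set S} :=
  [set x : S | [forall y : S, x * y == y * x]].

Record sgraph := SGraph {
  vertex : finType;
  edge : rel vertex;
  edge_sym : symmetric edge;
  edge_irr : irreflexive edge }.

Definition graph_cycle (G : sgraph) (c : seq (vertex G)) : Prop :=
  ucycle (@edge G) c /\ (3 <= size c)%N.

(* Girths live in option nat, with None standing for infinity. *)
Definition is_girth (G : sgraph) (g : option nat) : Prop :=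
  if g is Some k then
    (exists2 c : seq (vertex G), graph_cycle c & size c = k)
    /\ (forall c : seq (vertex G), graph_cycle c -> (k <= size c)%N)
  else forall c : seq (vertex G), ~ graph_cycle c.

Section CommutingGraph.

Variable S : finSemigroupType.

Definition noncentral : finType := {x : S | x \notin semigroup_center S}.

Definition commuting_edge : rel noncentral :=
  fun x y => (x != y) && (val x * val y == val y * val x).

Lemma commuting_edge_sym : symmetric commuting_edge.
Proof. by move=> x y; rewrite /commuting_edge eq_sym [val x * _ == _]eq_sym. Qed.

Lemma commuting_edge_irr : irreflexive commuting_edge.
Proof. by move=> x; rewrite /commuting_edge eqxx. Qed.

Definition commuting_graph : sgraph :=
  SGraph commuting_edge_sym commuting_edge_irr.

End CommutingGraph.

(* Main.v *)
(** A band is completely regular, with [x^-1 = x].  Let a left zero band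
    [B = {b_0, ..., b_(n-1)}] act on a left zero band [A = {a_(i,x)}], where each
    [b_j] maps the block [{a_(i,x) | x}] to one of its points: [a_(i,i)] if
    [i] is [j] or [j + 1] (mod n), and [a_(i,j)] otherwise.  Since the blocks
    do not depend on [j], this makes [A + B] a band.  Elements
    of [A] do not commute with each other, nor do elements of [B], and [b_j]
    commutes with [a] iff it fixes [a].  So [a_(i,i)] has the two
    neighbours [b_(i-1)] and [b_i], while the other [a_(i,x)] have at most one:
    the only cycle is [a_(0,0), b_0, a_(1,1), b_1, ...], of length [2n]. *)
Require Import Defs.
From HB Require Import structures.
From mathcomp Require Import all_boot.

Set Implicit Arguments.
Unset Strict Implicit.
Unset Printing Implicit Defensive.

(** Rotate [c] to start at [x]: the second and the last vertex serve, and they differ because [c] is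
    duplicate-free with at least three vertices. *)
Lemma ucycle_two_neighbors (T : eqType) (e : rel T) (c : seq T) (x : T) :
    symmetric e -> ucycle e c -> 3 <= size c -> x \in c ->
  exists y z, [/\ y \in c, z \in c, y != z, e x y & e x z].
Proof.
move=> e_sym /andP[cyc_c uniq_c] size_c /rot_to[k s def_s].
have mem_s: c =i x :: s by move=> y; rewrite -def_s mem_rot.
move: cyc_c uniq_c size_c.
rewrite -(rot_cycle k) -(rot_uniq k) -(size_rot k) def_s.
case: s mem_s {def_s} => [|y [|z s]] mem_s //=.
rewrite rcons_path /= => /and4P[exy _ _ elx] /and3P[_ y_notin _] _.
exists y, (last z s); rewrite !mem_s; split=> //.
- by rewrite !inE eqxx orbT.
- by rewrite 2!inE mem_last !orbT.
- by apply: contraNneq y_notin => ->; rewrite mem_last.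
- by rewrite e_sym.
Qed.

Lemma cycle_mkseq (T : Type) (e : rel T) (f : nat -> T) (N : nat) :
  (forall k, e (f k) (f k.+1)) -> f N = f 0 -> cycle e (mkseq f N).
Proof.
case: N => // N e_f fN; rewrite /mkseq /= -{2}fN.
have -> : rcons [seq f k | k <- iota 1 N] (f N.+1) = [seq f k | k <- iota 1 N.+1].
  by rewrite -(addn1 N) iotaD map_cat cats1 addn1 add1n.
by elim: N.+1 0 => //= l IHl k; rewrite e_f IHl.
Qed.

Lemma ordS_closed n (P : pred 'I_n) (i j : 'I_n) :
  (forall k, P k -> P (ordS k)) -> P i -> P j.
Proof.
move=> P_S Pi.
have val_iter k : iter k (@ordS n) i = (i + k) %% n :> nat.
  elim: k => [|k IHk]; first by rewrite addn0 modn_small.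
  by rewrite iterS /= IHk addnS -addn1 modnDml addn1.
(* [n - i] steps lead from [i] round to 0, and [j] more lead to [j]. *)
have <- : iter (n - i + j) (@ordS n) i = j.
  by apply: val_inj; rewrite /= val_iter addnA subnKC 1?ltnW// modnDl modn_small.
by elim: (n - i + j) => //= k /P_S.
Qed.

Lemma ordS_neq n (i : 'I_n) : 2 <= n -> ordS i != i.
Proof.
rewrite -val_eqE /= => n_ge2; case: (ltngtP i.+1 n) (ltn_ord i) => // [lt_i|eq_i] _.
  by rewrite modn_small// gtn_eqF.
by rewrite eq_i modnn eq_sym -lt0n -ltnS eq_i.
Qed.

(* [inl (i, x)] stands for [a_(i,x)] and [inr j] for [b_j]. *)
Definition cycle_band (n : nat) : Type := (('I_n * 'I_n) + 'I_n)%type.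

Section CycleBand.

Variable n : nat.
Local Notation band := (cycle_band n).

HB.instance Definition _ := Finite.on band.

(** The case [i = j] falls under the second branch, whose value [j] is then [i]. *)
Definition block_point (j i : 'I_n) : 'I_n := if i == ordS j then i else j.

Definition cycle_band_mul (u v : band) : band :=
  match u, v with
  | inr j, inl (i, _) => inl (i, block_point j i)
  | _, _ => u
  end.

Lemma cycle_band_mulA : associative cycle_band_mul.
Proof. by move=> [[i x]|i] [[j y]|j] [[k z]|k]. Qed.

HB.instance Definition _ := hasMul.Build band cycle_band_mul.
HB.instance Definition _ := Magma_isSemigroup.Build band cycle_band_mulA.


Lemma cycle_band_mulE (u v : band) : (u * v)%g = cycle_band_mul u v.
Proof. by []. Qed.

Lemma cycle_band_idem (u : band) : (u * u)%g = u.
Proof. by case: u => [[]|]. Qed.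

Lemma cycle_band_completely_regular : completely_regular band.
Proof. by exists id; split=> // u; rewrite !cycle_band_idem. Qed.

Definition cycle_band_adj (u v : band) : bool :=
  match u, v with
  | inl (i, x), inr j | inr j, inl (i, x) => x == block_point j i
  | _, _ => false
  end.

Lemma cycle_band_adj_sym : symmetric cycle_band_adj.
Proof. by move=> [[i x]|i] [[j y]|j]. Qed.

Lemma cycle_band_adjE (u v : band) :
  cycle_band_adj u v = (u != v) && ((u * v)%g == (v * u)%g).
Proof.
rewrite !cycle_band_mulE; case: u v => [[i x]|i] [[j y]|j] //=; try by case: eqP.
- by rewrite -[RHS]/((i, x) == (i, block_point j i)) xpair_eqE eqxx.
- by rewrite eq_sym -[RHS]/((j, block_point i j) == (j, y)) xpair_eqE eqxx.
Qed.

Lemma block_point_diag (j i : 'I_n) :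
  (i == block_point j i) = (i == ordS j) || (i == j).
Proof. by rewrite /block_point; case: ifP => //; rewrite eqxx. Qed.

(* [inl (i, x)] with [x != i] is adjacent at most to [inr x]. *)
Lemma cycle_band_two_neighbors_diag (i x : 'I_n) (v w : band) :
  v != w -> cycle_band_adj (inl (i, x)) v -> cycle_band_adj (inl (i, x)) w ->
  x = i.
Proof.
case: v w => [[? ?]|j] [[? ?]|k] //= neq_jk; rewrite /block_point.
case: ifP => _ /eqP // xj; case: ifP => _ /eqP // xk.
by rewrite -xj -xk eqxx in neq_jk.
Qed.

Section MinimalCycle.

Variable c : seq band.
Hypotheses (c_cycle : ucycle cycle_band_adj c) (size_c : 3 <= size c).

Let two_neighbors u :=
  @ucycle_two_neighbors _ _ _ u cycle_band_adj_sym c_cycle size_c.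

Lemma mem_cycle_diag (i x : 'I_n) : inl (i, x) \in c -> x = i.
Proof.
move=> /two_neighbors[v [w [_ _ neq_vw]]].
exact: cycle_band_two_neighbors_diag.
Qed.

(** Only diagonal points lie on [c], and just two of them are adjacent to [inr j], so both must be
    its neighbours on [c]. *)
Lemma mem_cycle_inr (j : 'I_n) :
  inr j \in c -> inl (j, j) \in c /\ inl (ordS j, ordS j) \in c.
Proof.
move=> /two_neighbors[[[i x]|?] [[[k y]|?] []]] //= ix_c ky_c.
have ? := mem_cycle_diag ix_c; have ? := mem_cycle_diag ky_c; subst x y.
rewrite !block_point_diag => neq_ik.
by case/orP=> /eqP? /orP[]/eqP ?; subst i k; rewrite ?eqxx in neq_ik.
Qed.

(** Any neighbour [inr j] with [j] other than [i] has [ordS j = i]; as [ordS] is injective, two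
    distinct neighbours cannot both be of that kind. *)
Lemma mem_cycle_inl (i : 'I_n) : inl (i, i) \in c -> inr i \in c.
Proof.
move=> /two_neighbors[[[? ?]|j] [[[? ?]|k] []]] //= j_c k_c neq_jk.
rewrite !block_point_diag => /orP[/eqP ij|/eqP->//] /orP[/eqP ik|/eqP->//].
by rewrite (ordS_inj (etrans (esym ij) ik)) eqxx in neq_jk.
Qed.

Lemma leq_size_cycle : 2 * n <= size c.
Proof.
have [j0 j0_c]: exists j0, inr j0 \in c.
  case: c size_c mem_cycle_inl (@mem_cycle_diag) => // -[[i x]|j] s _ inl_inr diag.
    have xi : x = i by apply: diag; rewrite mem_head.
    by exists i; apply: inl_inr; rewrite xi mem_head.
  by exists j; rewrite mem_head.
(* From [inr k] the cycle reaches [inl (ordS k, ordS k)], hence [inr (ordS k)], and so on all the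
   way round. *)
have inr_c j : inr j \in c.
  apply: (@ordS_closed n (fun k => inr k \in c) j0) => // k.
  by case/mem_cycle_inr=> _ /mem_cycle_inl.
pose f (s : 'I_n + 'I_n) : band := 
    match s with inl i => inl (i, i) | inr i => inr i end.
have f_inj : injective f by move=> [i|i] [j|j] //= [] ->.
have <- : size (map f (enum {: 'I_n + 'I_n})) = 2 * n.
  by rewrite size_map -cardE card_sum card_ord mul2n addnn.
apply: uniq_leq_size; first by rewrite map_inj_uniq ?enum_uniq.
by move=> _ /mapP[[i|i] _ ->] //=; have [] := mem_cycle_inr (inr_c i).
Qed.

End MinimalCycle.

Hypothesis n_ge2 : 2 <= n.

Lemma cycle_band_exists_noncommuting (u : band) : exists v, (u * v)%g != (v * u)%g.
Proof.
case: u => [[i x]|i].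
  exists (inl (ordS i, x)); apply/eqP=> -[] /eqP.
  by rewrite eq_sym (negPf (ordS_neq i n_ge2)).
exists (inr (ordS i)); apply/eqP=> -[] /(congr1 val)/val_inj/eqP.
by rewrite eq_sym (negPf (ordS_neq i n_ge2)).
Qed.

(** The center is empty, so the commuting graph has all of [band] as vertices. *)
Lemma cycle_band_noncentral (u : band) : u \notin semigroup_center band.
Proof.
have [v uv] := cycle_band_exists_noncommuting u.
by rewrite inE; apply: contraNN uv => /forallP.
Qed.

(** The cycle that attains the girth, as a walk of period [2 * n]: parity selects the band, and the
    half, modulo [n], the index. *)
Definition cycle_band_walk (k : nat) : band :=
  let i := Ordinal (ltn_pmod k./2 (ltnW n_ge2)) in
  if odd k then inr i else inl (i, i).

Lemma cycle_band_walk_adj k :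
  cycle_band_adj (cycle_band_walk k) (cycle_band_walk k.+1).
Proof.
rewrite /cycle_band_walk /= uphalf_half; case: odd => /=; rewrite block_point_diag.
  by rewrite -!val_eqE /= -[(_ %% n).+1]addn1 modnDml addn1 add1n eqxx.
by rewrite -!val_eqE /= eqxx orbT.
Qed.

Lemma cycle_band_walk_uniq : uniq (mkseq cycle_band_walk (2 * n)).
Proof.
(* Below [2 * n] no reduction modulo [n] takes place, so parity and half can be read off the vertex
   and determine [k]. *)
have half_lt k : k < 2 * n -> k./2 < n by rewrite mul2n ltn_half_double.
apply/mkseq_uniqP=> k l; rewrite !inE => /half_lt k_lt /half_lt l_lt.
move=> walk_kl; rewrite -[k]odd_double_half -[l]odd_double_half.
move: walk_kl; rewrite /cycle_band_walk.
by do 2!case: odd => //=; case; rewrite !modn_small// => ->.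
Qed.

Lemma cycle_band_girth : is_girth (commuting_graph band) (Some (2 * n)).
Proof.
pose h u : noncentral band := Sub u (cycle_band_noncentral u).
have edgeE (x y : noncentral band) :
  commuting_edge x y = cycle_band_adj (val x) (val y) by rewrite cycle_band_adjE.
split.
  exists (mkseq (h \o cycle_band_walk) (2 * n)); last by rewrite size_mkseq.
  split; last by rewrite size_mkseq (leq_trans _ (leq_mul (leqnn 2) n_ge2)).
  apply/andP; split.
    apply: cycle_mkseq => [k|]; first by rewrite /= edgeE cycle_band_walk_adj.
    (* The walk closes up: [2 * n] is even and its half [n] is 0 modulo [n]. *)
    apply: val_inj; rewrite /= /cycle_band_walk mul2n odd_double /=.
    by congr (inl (_, _)); apply: val_inj; rewrite /= doubleK modnn mod0n.
  rewrite /mkseq map_comp map_inj_uniq ?cycle_band_walk_uniq// => u v.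
  by move=> /(congr1 val).
move=> c [/andP[cyc_c uniq_c] size_c]; rewrite -(size_map val).
apply: leq_size_cycle; last by rewrite size_map.
rewrite /ucycle (map_inj_uniq val_inj) uniq_c andbT cycle_map.
by rewrite -(eq_cycle edgeE).
Qed.

End CycleBand.

Theorem theorem3p5 (n : nat) (hn : (2 <= n)%N) :
  exists S : finSemigroupType,
    [/\ ~ (forall x y : S, (x * y)%g = (y * x)%g),
        completely_regular S
      & is_girth (commuting_graph S) (Some (2 * n)%N)].
Proof.
exists (cycle_band n); split.
(* [hn] unfolds to [1 < n], so the chosen element is [b_1]. *)
- move=> mulC; have [v] := cycle_band_exists_noncommuting hn (inr (Ordinal hn)).
  by rewrite mulC eqxx.
- exact: cycle_band_completely_regular.
- exact: cycle_band_girth.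
Qed.
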